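(* Let $G$ be a finite simple connected graph that contains no induced subgraph isomorphic to $P_5$ or to $K_1+(K_1\cup K_3)$. Then $\chi(G)\le 3\omega(G)+11$.
   Context: $P_5$ is the path on 5 vertices, $K_t$ the complete graph on $t$ vertices. For disjoint graphs $F_1,F_2$, $F_1\cup F_2$ is their disjoint union and $F_1+F_2$ is the join (disjoint union plus all edges between $V(F_1)$ and $V(F_2)$). Thus $K_1+(K_1\cup K_3)$ is a vertex adjacent to all vertices of the disjoint union of a single vertex and a triangle. $\chi$ is the chromatic number and $\omega$ the clique number. *)

(* Defs.v *)
From mathcomp Require Import all_boot.

Set Implicit Arguments.
Unset Strict Implicit.
Unset Printing Implicit Defensive.

Record sgraph := SGraph {
  vertex :> finType;
  adj : rel vertex;
  adj_sym : symmetric adj;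
  adj_irrefl : irreflexive adj }.

Definition iso (G H : sgraph) : Prop :=
  exists2 f : G -> H, bijective f & forall x y, adj (f x) (f y) = adj x y.

Section Induced.
Variables (G : sgraph) (S : {set G}).

Definition induced_rel : rel {x : G | x \in S} :=
  fun x y => adj (val x) (val y).

Lemma induced_sym : symmetric induced_rel.
Proof. by move=> x y; exact: adj_sym. Qed.

Lemma induced_irrefl : irreflexive induced_rel.
Proof. by move=> x; exact: adj_irrefl. Qed.

Definition induced : sgraph := SGraph induced_sym induced_irrefl.
End Induced.

Definition induced_free (H G : sgraph) : Prop :=
  forall S : {set G}, ~ iso (induced S) H.

(* The graph without vertices satisfies this predicate. *)
Definition connected (G : sgraph) : Prop :=
  forall x y : G, connect (@adj G) x y.

Section Path.
Variable n : nat.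

Definition path_rel : rel 'I_n := fun i j => (i.+1 == j) || (j.+1 == i).

Lemma path_sym : symmetric path_rel.
Proof. by move=> i j; rewrite /path_rel orbC. Qed.

Lemma path_irrefl : irreflexive path_rel.
Proof. by move=> i; rewrite /path_rel orbb gtn_eqF. Qed.

Definition path_graph : sgraph := SGraph path_sym path_irrefl.
End Path.

Section Complete.
Variable n : nat.

Definition complete_rel : rel 'I_n := fun i j => i != j.

Lemma complete_sym : symmetric complete_rel.
Proof. by move=> i j; rewrite /complete_rel eq_sym. Qed.

Lemma complete_irrefl : irreflexive complete_rel.
Proof. by move=> i; rewrite /complete_rel eqxx. Qed.

Definition complete : sgraph := SGraph complete_sym complete_irrefl.
End Complete.

Section UnionJoin.
Variables F1 F2 : sgraph.

(* [b] tells whether vertices of different summands are adjacent. *)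
Definition sum_rel (b : bool) : rel (F1 + F2)%type := fun u v =>
  match u, v with
  | inl x, inl y => adj x y
  | inr x, inr y => adj x y
  | _, _ => b
  end.

Lemma sum_sym b : symmetric (sum_rel b).
Proof. by move=> [x|x] [y|y] //=; exact: adj_sym. Qed.

Lemma sum_irrefl b : irreflexive (sum_rel b).
Proof. by move=> [x|x] /=; exact: adj_irrefl. Qed.

Definition disjoint_union : sgraph := SGraph (sum_sym false) (sum_irrefl false).
Definition join : sgraph := SGraph (sum_sym true) (sum_irrefl true).
End UnionJoin.

Definition proper_coloring (G : sgraph) (k : nat) (c : {ffun G -> 'I_k}) : bool :=
  [forall x, forall y, adj x y ==> (c x != c y)].

Definition colorable (G : sgraph) (k : nat) : bool :=
  [exists c : {ffun G -> 'I_k}, proper_coloring c].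

Lemma ex_colorable (G : sgraph) : exists k, colorable G k.
Proof.
exists #|G|; apply/existsP; exists [ffun x => enum_rank x].
apply/forallP=> x; apply/forallP=> y; apply/implyP=> xy.
rewrite !ffunE (inj_eq enum_rank_inj).
by apply: contraTneq xy => ->; rewrite adj_irrefl.
Qed.

Definition chromatic_number (G : sgraph) : nat := ex_minn (ex_colorable G).

Definition clique (G : sgraph) (A : {set G}) : bool :=
  [forall x in A, forall y in A, (x != y) ==> adj x y].

Definition clique_number (G : sgraph) : nat := \max_(A : {set G} | clique A) #|A|.

(* Main.v *)
Require Import Defs.
From mathcomp Require Import all_boot.

Set Implicit Arguments.
Unset Strict Implicit.
Unset Printing Implicit Defensive.

(** [K_1 + (K_1 \cup K_3)] is [K_4] with a pendant edge.  Hence, for every edge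
    [k u], the set [T k u] of the neighbours of [u] that are not adjacent to [k]
    is triangle-free, so 3-colorable by a Gyarfas-type argument ([P_5]-free
    graphs of clique number at most [n + 1] are [3 ^ n]-colorable).
    If [omega <= 2] then 3 colors suffice.  Otherwise let [K] be a
    maximum clique and [w, u, u'] three of its vertices.  A vertex with a
    neighbour in [K] misses at most two vertices of [K], and a vertex outside
    [K] misses at least one, so the vertices of [K] and its neighbours are
    covered by [T w u], [T w u'] and the sets [T k w] with [k] in [K :\ w].
    Finally, by [P_5]-freeness each component of the vertices at distance at
    least 2 from [K] is complete to some neighbour [q] of some [a] in [K], so
    it lies in [T a q].  This gives [3 * (omega - 1) + 6 + 3] colors. *)

(** * Edges leaving a set, and maps onto induced subgraphs *)

Lemma connect_cross (T : finType) (e : rel T) (P : pred T) x y :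
  connect e x y -> P x -> ~~ P y ->
  exists a b, [/\ connect e x a, P a, ~~ P b & e a b].
Proof.
move=> /connectP[p + ->]; elim: p x => [|z p IH] x /=; first by move=> _ ->.
case/andP=> xz zp Px nP; have [Pz|nPz] := boolP (P z).
  have [a [b [za Pa nPb ab]]] := IH z zp Pz nP.
  by exists a, b; split=> //; apply: connect_trans (connect1 xz) za.
by exists x, z.
Qed.

(** If [f x = f y], then [x] and [y] have the same neighbours, so the absence of twins in [H] makes
    [f] injective. Its image then induces a copy of [H]. *)
Lemma embedding_not_free (H G : sgraph) (f : H -> G) :
  (forall x y, adj (f x) (f y) = adj x y) ->
  (forall x y : H, (forall z, adj x z = adj y z) -> x = y) ->
  ~ induced_free H G.
Proof.
move=> fE twinfree free.
have inj_f : injective f.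
  by move=> x y fxy; apply: twinfree => z; rewrite -!fE fxy.
pose S := f @: [set: H].
have fS x : f x \in S by rewrite imset_f ?inE.
pose g (x : H) : induced S := exist _ (f x) (fS x).
have inj_g : injective g by move=> x y [/inj_f].
have surj (y : induced S) : exists x, g x == y.
  case: y => y yS; have /imsetP[x _ yx] := yS.
  by exists x; apply/eqP/val_inj; rewrite /= yx.
pose h y := xchoose (surj y).
have hK : cancel h g by move=> y; apply/eqP; exact: xchooseP (surj y).
have gK : cancel g h by move=> x; apply: inj_g; rewrite hK.
apply: (free S); exists h; first by exists g.
by move=> x y; rewrite -{2}(hK x) -{2}(hK y) /adj /= /induced_rel /= fE.
Qed.

(** * The two forbidden subgraphs as adjacency patterns *)

Section Graph.
Variable G : sgraph.
Implicit Types (S A B C : {set G}) (x y z : G).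

(** The ten adjacency conditions force the five vertices to be distinct. *)
Definition P5_free := forall a b c d e : G,
  [/\ adj a b, adj b c, adj c d & adj d e] ->
  [/\ ~~ adj a c, ~~ adj a d & ~~ adj a e] ->
  [/\ ~~ adj b d, ~~ adj b e & ~~ adj c e] -> False.

Definition pendant_K4_free := forall u p a b c : G,
  [/\ adj u p, adj u a, adj u b & adj u c] ->
  [/\ adj a b, adj a c & adj b c] ->
  [/\ ~~ adj p a, ~~ adj p b & ~~ adj p c] -> False.

Lemma induced_P5_free : induced_free (path_graph 5) G -> P5_free.
Proof.
move=> free a b c d e [ab bc cd de] [/negPf ac /negPf ad /negPf ae].
move=> [/negPf bd /negPf be /negPf ce].
pose f (i : path_graph 5) := tnth [tuple a; b; c; d; e] i.
apply: (embedding_not_free (f := f)) free.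
  by move=> [[|[|[|[|[|//]]]]] ?] [[|[|[|[|[|//]]]]] ?];
    rewrite /f !(tnth_nth a) /= ?adj_irrefl // 1?adj_sym.
move=> x y xy; apply: val_inj.
move: (xy (@Ordinal 5 0 isT)) (xy (@Ordinal 5 1 isT)) (xy (@Ordinal 5 2 isT)).
move: (xy (@Ordinal 5 3 isT)) (xy (@Ordinal 5 4 isT)) => {xy}.
by move: x y => [[|[|[|[|[|//]]]]] ?] [[|[|[|[|[|//]]]]] ?].
Qed.

Lemma induced_pendant_K4_free :
  induced_free (join (complete 1) (disjoint_union (complete 1) (complete 3))) G ->
  pendant_K4_free.
Proof.
move=> free u p a b c [up ua ub uc] [ab ac bc] [/negPf pa /negPf pb /negPf pc].
pose f (i : join (complete 1) (disjoint_union (complete 1) (complete 3))) :=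
  match i with
  | inl _ => u | inr (inl _) => p | inr (inr i) => tnth [tuple a; b; c] i
  end.
apply: (embedding_not_free (f := f)) free.
  by move=> [[[|//] ?]|[[[|//] ?]|[[|[|[|//]]] ?]]];
    move=> [[[|//] ?]|[[[|//] ?]|[[|[|[|//]]] ?]]];
    rewrite /f ?(tnth_nth a) /= ?adj_irrefl // 1?adj_sym.
move=> x y xy.
move: (xy (inl ord0)) (xy (inr (inl ord0))) (xy (inr (inr (@Ordinal 3 0 isT)))).
move: (xy (inr (inr (@Ordinal 3 1 isT)))) (xy (inr (inr (@Ordinal 3 2 isT)))).
move: x y {xy} => [[[|//] ?]|[[[|//] ?]|[[|[|[|//]]] ?]]];
  move=> [[[|//] ?]|[[[|//] ?]|[[|[|[|//]]] ?]]] //= *;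
  by do ?congr inr; do ?congr inl; apply: val_inj.
Qed.

(** * Colorings of vertex sets *)

(** Colorings are total functions into [nat], so they can be shifted and glued without subtypes. *)
Definition colorable_on S k := exists c : G -> nat,
  {in S, forall x, c x < k} /\ {in S &, forall x y, adj x y -> c x <> c y}.

Lemma colorable_onS A B k : A \subset B -> colorable_on B k -> colorable_on A k.
Proof.
move=> /subsetP AB [c [ck cP]]; exists c; split=> [x /AB/ck //|x y /AB xB /AB].
exact: cP.
Qed.

Lemma colorable_onU A B a b :
  colorable_on A a -> colorable_on B b -> colorable_on (A :|: B) (a + b).
Proof.
move=> [c [ca cP]] [d [db dP]].
exists (fun x => if x \in A then c x else a + d x); split=> [x|x y].
  rewrite inE; case: ifP => [/ca ? _|_ /= /db]; last by rewrite ltn_add2l.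
  by rewrite ltn_addr.
rewrite !inE; case: ifP => [xA _|_ /= xB]; case: ifP => [yA _|_ /= yB] xy.
- exact: cP.
- by move=> cE; have := ca x xA; rewrite cE ltnNge leq_addr.
- by move=> cE; have := ca y yA; rewrite -cE ltnNge leq_addr.
- by move=> /addnI; apply: dP.
Qed.

Lemma colorable_on_bigcup (I : Type) (r : seq I) (F : I -> {set G}) k :
  (forall i, colorable_on (F i) k) ->
  colorable_on (\bigcup_(i <- r) F i) (k * size r).
Proof.
move=> FP; elim: r => [|i r IH].
  by rewrite big_nil; exists (fun=> 0); split=> x; rewrite inE.
by rewrite big_cons mulnS; apply: colorable_onU.
Qed.

Lemma colorable_on_setT k : colorable_on [set: G] k -> chromatic_number G <= k.
Proof.
move=> [c [ck cP]]; rewrite /chromatic_number; case: ex_minnP => m _; apply.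
apply/existsP; exists [ffun x => Ordinal (ck x (in_setT x))].
apply/forallP=> x; apply/forallP=> y; apply/implyP=> xy; rewrite !ffunE.
by apply/eqP=> -[]; apply: cP; rewrite ?inE.
Qed.

(** * Components of vertex sets *)

Definition adj_on S : rel G := fun x y => [&& x \in S, y \in S & adj x y].

Definition comp S x := [set y | connect (adj_on S) x y].

Lemma adj_on_sym S : symmetric (adj_on S).
Proof. by move=> x y; rewrite /adj_on adj_sym andbCA. Qed.

Lemma adj_on_connect_sym S : connect_sym (adj_on S).
Proof. exact/sym_connect_sym/adj_on_sym. Qed.

Lemma mem_comp S x : x \in comp S x.
Proof. by rewrite inE. Qed.

Lemma comp_sub S x : x \in S -> comp S x \subset S.
Proof.
move=> xS; apply/subsetP=> y; rewrite inE => xy; apply/negPn/negP=> yS.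
by have [a [b [_ _ /negP bS /and3P[_ /bS]]]] := connect_cross xy xS yS.
Qed.

Lemma comp_adj S x a b : a \in comp S x -> adj_on S a b -> b \in comp S x.
Proof. by rewrite !inE => xa ab; apply: connect_trans xa (connect1 ab). Qed.

Lemma comp_connect S x a b :
  a \in comp S x -> b \in comp S x -> connect (adj_on S) a b.
Proof. by rewrite !inE [connect _ x a]adj_on_connect_sym; apply: connect_trans. Qed.

Lemma colorable_on_comp S k :
  {in S, forall x, colorable_on (comp S x) k} -> colorable_on S k.
Proof.
move=> compP.
have ex x : exists c : G -> nat, x \in S ->
    {in comp S x, forall y, c y < k} /\
    {in comp S x &, forall y z, adj y z -> c y <> c z}.
  have [xS|xS] := boolP (x \in S); last by exists (fun=> 0).
  by have [c cP] := compP x xS; exists c.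
have [f fP] := fin_all_exists ex.
(* Adjacent vertices must use the same coloring, so each vertex takes the one chosen at the
   canonical root of its component. *)
pose r := root (adj_on S).
have rx x : connect (adj_on S) (r x) x.
  by rewrite adj_on_connect_sym connect_root.
have rS x : x \in S -> r x \in S.
  by move=> xS; apply: (subsetP (comp_sub xS)); rewrite inE connect_root.
exists (fun x => f (r x) x); split=> [x xS|x y xS yS xy].
  by have [+ _] := fP _ (rS x xS); apply; rewrite inE.
have rxy : r x = r y.
  apply/eqP; rewrite root_connect; last exact: adj_on_connect_sym.
  by apply: connect1; rewrite /adj_on xS yS.
have [_ +] := fP _ (rS x xS); rewrite -rxy; apply; rewrite ?inE //.
by rewrite rxy.
Qed.

(** Otherwise some edge [s t'] of the component has [q] adjacent to [s] but not to [t'], and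
    [a, b, q, s, t'] is an induced [P_5]. *)
Lemma comp_complete S z a b q p :
  P5_free ->
  [/\ adj a b, adj b q & ~~ adj a q] ->
  {in S, forall s, ~~ adj a s} -> {in S, forall s, ~~ adj b s} ->
  p \in comp S z -> adj q p -> {in comp S z, forall t, adj q t}.
Proof.
move=> free [ab bq aq] aS bS pz qp t tz; apply/negPn/negP=> nqt.
have pt := comp_connect pz tz.
have [s [t' [_ qs qt' /and3P[sS t'S st']]]] :=
  connect_cross (P := adj q) pt qp nqt.
by apply: (free a b q s t'); split=> //; [exact: aS|exact: aS|exact: bS|exact: bS].
Qed.

(** * Bounded clique number *)

Definition clique_le n S := forall A, A \subset S -> clique A -> #|A| <= n.

Lemma cliqueP A : reflect {in A &, forall x y, x != y -> adj x y} (clique A).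
Proof.
apply: (iffP forall_inP) => [AP x y xA yA|AP x xA].
  by have /forall_inP/(_ y yA)/implyP := AP x xA.
by apply/forall_inP=> y yA; apply/implyP; apply: AP.
Qed.

Lemma cliqueU1 A x : clique A -> {in A, forall y, adj x y} -> clique (x |: A).
Proof.
move=> /cliqueP AP xA; apply/cliqueP=> y z; rewrite !inE.
move=> /orP[/eqP->|yA] /orP[/eqP->|zA]; rewrite ?eqxx // => yz.
- exact: xA.
- by rewrite adj_sym xA.
- exact: AP.
Qed.

Lemma clique_le_neighbors n S A x : clique_le n.+1 S -> x \in S ->
  A \subset S -> {in A, forall y, adj x y} -> clique_le n A.
Proof.
move=> SP xS AS xA B BA Bcl.
have xB y : y \in B -> adj x y by move=> /(subsetP BA)/xA.
have nxB : x \notin B by apply/negP=> /xB; rewrite adj_irrefl.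
have := SP (x |: B); rewrite cardsU1 nxB add1n ltnS; apply.
  by rewrite subUset sub1set xS (subset_trans BA).
exact: cliqueU1.
Qed.

(** By induction on [n]: each vertex set complete to a vertex of [S] costs [3 ^ n] colors. Three
    such families suffice: the neighbours of [v]; in each component [D] of the rest, the neighbours
    of a suitable [x]; and the components of what remains of [D], each complete to some [q]. *)
Lemma colorable_on_clique_le n S :
  P5_free -> clique_le n.+1 S -> colorable_on S (3 ^ n).
Proof.
move=> free; elim: n S => [|n IH] S SP.
  exists (fun=> 0); split=> // x y xS yS xy _.
  have nxy : x != y by apply: contraTneq xy => ->; rewrite adj_irrefl.
  suff: #|[set x; y]| <= 1 by rewrite cards2 nxy.
  apply: SP; first by apply/subsetP=> z; rewrite !inE => /orP[] /eqP->.
  apply: cliqueU1 => [|z]; last by rewrite inE => /eqP->.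
  by apply/cliqueP=> z t; rewrite !inE => /eqP-> /eqP->; rewrite eqxx.
have IHN A x : A \subset S -> x \in S -> {in A, forall y, adj x y} ->
    colorable_on A (3 ^ n).
  by move=> AS xS xA; apply: IH; exact: clique_le_neighbors SP xS AS xA.
apply: colorable_on_comp => v vS; have CS := comp_sub vS.
set C := comp S v in CS *; set R := C :\: [set x | adj v x].
have RC : R \subset C by rewrite subsetDl.
have RS : R \subset S := subset_trans RC CS.
have vR : v \in R by rewrite !inE adj_irrefl connect0.
rewrite -(setID C [set x | adj v x]) expnS mulSn.
apply: colorable_onU.
  apply: (IHN _ v) => //; first by rewrite (subset_trans (subsetIl _ _)).
  by move=> y; rewrite !inE => /andP[].
apply: colorable_on_comp => y yR; set D := comp R y.
have DR : D \subset R := comp_sub yR.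
have DS : D \subset S := subset_trans DR RS.
have [vD|vD] := boolP (v \in D).
  exists (fun=> 0); split=> [x _|x z xD zD xz _].
    by rewrite muln_gt0 expn_gt0.
  (* [R] contains [v] but none of its neighbours. *)
  have isolated t : t \in D -> t = v.
    move=> tD; apply/eqP/negPn/negP=> tv.
    have vt := comp_connect vD tD.
    have [a [b [_ /eqP-> _]]] := connect_cross (P := pred1 v) vt (eqxx v) tv.
    by rewrite /adj_on !inE => /and3P[_ /andP[/negP]].
  by move: xz; rewrite (isolated x) // (isolated z) // adj_irrefl.
have yC : y \in C := subsetP RC _ yR.
have vC : v \in C := subsetP RC _ vR.
have yv := comp_connect yC vC.
(* A walk from [y] to [v] leaves [D] by an edge [p x]. As [D] is a component of [R], [x] lies in [C]
   but not in [R], so it is a neighbour of [v]. *)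
have [p [x [_ pD xD /and3P[pS xS px]]]] :=
  connect_cross (P := mem D) yv (mem_comp R y) vD.
have pR := subsetP DR p pD.
have xC : x \in C.
  apply: (@comp_adj S v p); first exact: (subsetP RC).
  by rewrite /adj_on pS xS.
have vx : adj v x.
  apply/negPn/negP=> nvx; case/negP: xD; apply: (comp_adj pD).
  by rewrite /adj_on pR px in_setD xC inE nvx.
have vD' s : s \in R -> ~~ adj v s by rewrite !inE => /andP[].
rewrite -(setID D [set z | adj x z]) mulSn mul1n.
apply: colorable_onU.
  apply: (IHN _ x) => //; first by rewrite (subset_trans (subsetIl _ _)).
  by move=> z; rewrite !inE => /andP[].
set Q := D :\: _; have QD : Q \subset D by rewrite subsetDl.
apply: colorable_on_comp => z zQ; have EQ := comp_sub zQ.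
have zD := subsetP QD z zQ; have zp := comp_connect zD pD.
have nxE s : s \in Q -> ~~ adj x s by rewrite !inE => /andP[].
have pE : p \notin comp Q z.
  by apply/negP=> /(subsetP EQ)/nxE; rewrite adj_sym px.
(* The same exit argument inside [D]: [q] is in [D] but not in [Q], hence adjacent to [x]. *)
have [s [q [zs sE qE sq]]] :=
  connect_cross (P := mem (comp Q z)) zp (mem_comp Q z) pE.
have sQ := subsetP EQ s sE; have sD := subsetP QD s sQ.
have qD := comp_adj sD sq; case/and3P: (sq) => sR qR adjsq.
have xq : adj x q.
  apply/negPn/negP=> nxq; case/negP: qE; apply: (comp_adj sE).
  by rewrite /adj_on sQ adjsq in_setD qD inE nxq.
apply: (IHN _ q); first exact: subset_trans EQ (subset_trans QD DS).
  exact: (subsetP RS).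
apply: (comp_complete (a := v) (b := x) (p := s)) => //.
- by split; rewrite ?vD'.
- by move=> t /(subsetP QD)/(subsetP DR)/vD'.
- by rewrite adj_sym.
Qed.

(** * Neighbours of a maximum clique *)

Lemma colorable_on_pendant k u : P5_free -> pendant_K4_free -> adj k u ->
  colorable_on [set v | ~~ adj k v & adj u v] 3.
Proof.
move=> free5 freeH ku; apply: (@colorable_on_clique_le 1) => // A /subsetP AT.
move=> /cliqueP Acl; rewrite leqNgt; apply/negP.
move=> /card_gt2P[a [b [c [[aA bA cA] [ab bc ca]]]]].
have:= AT a aA; have:= AT b bA; have:= AT c cA.
rewrite !inE => /andP[kc uc] /andP[kb ub] /andP[ka ua].
apply: (freeH u k a b c); split=> //; first by rewrite adj_sym.
- exact: Acl.
- by rewrite adj_sym; apply: Acl.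
- exact: Acl.
Qed.

(** Otherwise [a, k1, k2, k3] is a [K_4] with [v] pendant at [a]. *)
Lemma clique_few_non_neighbors (K : {set G}) v a k1 k2 k3 :
  pendant_K4_free -> clique K ->
  [/\ a \in K, k1 \in K, k2 \in K & k3 \in K] ->
  [/\ k1 != k2, k2 != k3 & k3 != k1] -> adj v a ->
  [|| adj v k1, adj v k2 | adj v k3].
Proof.
move=> freeH /cliqueP Kcl [aK k1K k2K k3K] [k12 k23 k31] va.
apply/negPn/negP; rewrite !negb_or => /and3P[n1 n2 n3].
have adja k : k \in K -> ~~ adj v k -> adj a k.
  by move=> kK nk; apply: Kcl => //; apply: contraNneq nk => <-.
have k13 : k1 != k3 by rewrite eq_sym.
by apply: (freeH a v k1 k2 k3); split=> //;
  (exact: adja || exact: Kcl || rewrite adj_sym).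
Qed.

Lemma maximum_clique_colorable (K : {set G}) : connected G ->
  P5_free -> pendant_K4_free -> clique K ->
  (forall A, clique A -> #|A| <= #|K|) -> 2 < #|K| ->
  colorable_on [set: G] (3 * #|K| + 6).
Proof.
move=> conn free5 freeH Kcl Kmax.
move=> /card_gt2P[w [u [u' [[wK uK u'K] [wu uu' u'w]]]]].
have /cliqueP Kadj := Kcl.
pose T (k u : G) := [set v | ~~ adj k v & adj u v].
have TP k l : adj k l -> colorable_on (T k l) 3 by apply: colorable_on_pendant.
have missing v : v \notin K -> exists2 k, k \in K & ~~ adj v k.
  move=> vK; apply/exists_inP; apply: contraT => /exists_inPn vP.
  suff /Kmax : clique (v |: K) by rewrite cardsU1 vK ltnn.
  by apply: cliqueU1 => // k /vP; rewrite negbK.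
pose N2 := [set v | [forall k in K, ~~ adj v k]].
have N2P : colorable_on N2 3.
  apply: colorable_on_comp => y yN.
  have N2adj v k : v \in N2 -> k \in K -> ~~ adj v k.
    by rewrite inE => /forall_inP; apply.
  have CN := comp_sub yN; set C := comp N2 y in CN *.
  have wC : w \notin C.
    apply/negP=> /(subsetP CN) wN; have := N2adj w u wN uK.
    by rewrite Kadj.
  (* The exit vertex [q] is not in [N2], else it would be in [C], nor in [K], as [p] has no
     neighbour there. So it sees some [a] and misses some [k] in [K], and [k, a, q] starts the [P_5]
     that makes [q] complete to [C]. *)
  have [p [q [_ pC qC pq]]] :=
    connect_cross (P := mem C) (conn y w) (mem_comp N2 y) wC.
  have pN := subsetP CN p pC.
  have qN : q \notin N2.
    apply: contra qC => qN; apply: (comp_adj pC).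
    by rewrite /adj_on pN qN.
  have [a aK qa] : exists2 a, a \in K & adj q a.
    by move: qN; rewrite inE => /forall_inPn[a aK /negPn]; exists a.
  have qK : q \notin K.
    by apply/negP=> qK; have := N2adj p q pN qK; rewrite pq.
  have [k kK qk] := missing q qK.
  have ak : a != k by apply: contraNneq qk => <-.
  apply: colorable_onS (TP a q _); last by rewrite adj_sym.
  have qC' : {in C, forall t, adj q t}.
    apply: (comp_complete (a := k) (b := a) (p := p)) => //.
    - split; [by apply: Kadj; rewrite // eq_sym | by rewrite adj_sym |].
      by rewrite adj_sym.
    - by move=> s sN; rewrite adj_sym N2adj.
    - by move=> s sN; rewrite adj_sym N2adj.
    - by rewrite adj_sym.
  apply/subsetP=> t tC; rewrite inE qC' // andbT adj_sym.
  by rewrite N2adj // (subsetP CN).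
(* The default [set0] keeps every [F k] 3-colorable, also when [k] and [w] are not adjacent. *)
pose F k := if k \in K :\ w then T k w else set0.
have FP k : colorable_on (F k) 3.
  rewrite /F; case: ifP => [|_].
    by rewrite !inE => /andP[kw kK]; apply: TP; apply: Kadj.
  by exists (fun=> 0); split=> x; rewrite inE.
have bigP : colorable_on (\bigcup_(k <- enum (K :\ w)) F k) (3 * #|K :\ w|).
  by rewrite cardE; apply: colorable_on_bigcup.
have TwP l : l \in K -> w != l -> colorable_on (T w l) 3.
  by move=> lK wl; apply: TP; apply: Kadj.
have wu' : w != u' by rewrite eq_sym.
have ->: 3 * #|K| + 6 = 3 * #|K :\ w| + (3 + 3 + 3).
  by rewrite (cardsD1 w K) wK mulnDr addnC [RHS]addnC addnA.
apply: colorable_onS (colorable_onU bigP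
  (colorable_onU (colorable_onU (TwP u uK wu) (TwP u' u'K wu')) N2P)).
apply/subsetP=> v _.
have inF k : k \in K :\ w -> v \in T k w ->
    v \in \bigcup_(k <- enum (K :\ w)) F k.
  move=> kK vT; rewrite big_enum; apply/bigcupP; exists k => //.
  by rewrite /F kK.
have [vN|vN] := boolP (v \in N2); first by rewrite !in_setU vN !orbT.
have [a aK va] : exists2 a, a \in K & adj v a.
  by move: vN; rewrite inE => /forall_inPn[a aK /negPn]; exists a.
(* If [v] misses [w], its neighbour [a] in [K] forces it to see [u] or [u'], which puts it in
   [T w u] or [T w u']. *)
have [vw|vw] := boolP (adj v w); last first.
  have: [|| adj v w, adj v u | adj v u'].
    exact: (@clique_few_non_neighbors K v a w u u').
  rewrite (negPf vw) !inE !(adj_sym _ v) vw /= => /orP[] ->;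
    by rewrite ?orbT.
(* Now [v] sees [w]. Any [k] in [K] that [v] misses ([v] itself if it is in [K]) differs from [w],
   so [v] is in [T k w]. *)
have [k kK vk] : exists2 k, k \in K & ~~ adj v k.
  have [vK|] := boolP (v \in K); last exact: missing.
  by exists v; rewrite // adj_irrefl.
rewrite inE (inF k) //.
  by rewrite !inE kK andbT; apply: contraNneq vk => ->.
by rewrite inE !(adj_sym _ v) vk.
Qed.

End Graph.

Theorem theorem1p4 (G : sgraph) :
  connected G ->
  induced_free (path_graph 5) G ->
  induced_free (join (complete 1) (disjoint_union (complete 1) (complete 3))) G ->
  chromatic_number G <= 3 * clique_number G + 11.
Proof.
move=> conn /induced_P5_free free5 /induced_pendant_K4_free freeH.
have cl0 : clique (set0 : {set G}) by apply/cliqueP=> x y; rewrite inE.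
have [K Kcl Kmax] := @arg_maxnP _ set0 (@clique G) (fun A => #|A|) cl0.
have [K2|K3] := leqP #|K| 2.
  (* All cliques have at most two vertices, and the bound [3 ^ n] with [n = 1] gives 3 colors. *)
  apply: (@leq_trans 3); last by rewrite (leq_trans _ (leq_addl _ _)).
  apply: colorable_on_setT; apply: (@colorable_on_clique_le _ 1) => // A _ Acl.
  by apply: leq_trans K2; apply: Kmax.
apply: leq_trans (colorable_on_setT
  (maximum_clique_colorable conn free5 freeH Kcl Kmax K3)) _.
by rewrite leq_add // leq_mul2l; apply: leq_bigmax_cond Kcl.
Qed.
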